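(* Let $n\ge1$ and let $(\pi,V)$, $(\pi',V')$ be $R[G_n]$-modules of Whittaker type such that $(V,V')$ is not an exceptional pair. Write $\mathcal{W}=\mathcal{W}(V,\psi_R)$ and $\mathcal{W}'=\mathcal{W}(V',\psi_R^{-1})$. Then the $R$-module $\mathrm{Hom}_{R[G_n]}(\mathcal{W}\otimes_R\mathcal{W}'\otimes_R C(\mathbb{F}_q^n,R),\mathbf{1})$ of $G_n$-invariant trilinear forms is free of rank one, generated by \[I(W,W',\Phi)=\sum_{g\in N_n\backslash G_n}W(g)W'(g)\Phi(\eta g),\qquad \eta=(0,\dots,0,1).\]
   Context: Let $p$ be a prime, $q$ a power of $p$, $G_n=\mathrm{GL}_n(\mathbb{F}_q)$, $R$ a commutative Noetherian $\mathbb{Z}[\frac1p,\zeta_p]$-algebra with $0\neq1$. Fix nontrivial $\psi:(\mathbb{F}_q,+)\to\mathbb{Z}[\frac1p,\zeta_p]^\times$, $\psi_R$ its image in $R^\times$, a character of the upper unipotent group $N_n$ via $u\mapsto\psi_R(\sum_i u_{i,i+1})$. $C(\mathbb{F}_q^n,R)$ is the set of all functions $\mathbb{F}_q^n\to R$ (row vectors) with $G_n$-action $(g\cdot f)(x)=f(xg)$; $G_n$ acts diagonally on the tensor product, and on Whittaker models by right translation. $P_n$ is the mirabolic subgroup (last row $(0,\dots,0,1)$), $U_n=\{\begin{psmallmatrix}I_{n-1}&y\\0&1\end{psmallmatrix}\}$ with $\psi_R$ evaluated at $y_{n-1}$. For an $R[P_n]$-module $V$: $\Phi^-(V)=V/\langle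 uv-\psi_R(u)v\rangle_{u\in U_n}$ (an $R[P_{n-1}]$-module), $\Psi^-(V)=V/\langle uv-v\rangle_{u\in U_n}$ (an $R[G_{n-1}]$-module), $V^{(k)}=\Psi^-(\Phi^-)^{k-1}(V)$ for $1\le k\le n$; $V^{(n)}$ is the $(N_n,\psi_R)$-coinvariants. $V$ is of Whittaker type if $V^{(n)}$ is free of rank one; a generator $\lambda$ of $\mathrm{Hom}_R(V^{(n)},R)$ gives $V\to\mathrm{Ind}_{N_n}^{G_n}\psi_R$, $v\mapsto(g\mapsto\lambda(\overline{gv}))$, with image the Whittaker model $\mathcal{W}(V,\psi_R)$; similarly with $\psi_R^{-1}$. $(V,V')$ is an exceptional pair if for some $t\in\{1,\dots,n\}$ there is a nonzero $G_t$-invariant $R$-bilinear form on $\mathcal{W}(V,\psi_R)^{(n-t)}\times\mathcal{W}(V',\psi_R^{-1})^{(n-t)}$ (the latter derivative with respect to $\psi_R^{-1}$). *)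

(* Defs.v *)
From HB Require Import structures.
From mathcomp Require Import all_boot all_order all_algebra.
Set Implicit Arguments. Unset Strict Implicit. Unset Printing Implicit Defensive.
Import GRing.Theory.
Local Open Scope ring_scope.

Definition is_ideal (R : comNzRingType) (I : R -> Prop) : Prop :=
  [/\ I 0, (forall x y, I x -> I y -> I (x + y)) & (forall a x, I x -> I (a * x))].

Definition noetherian (R : comNzRingType) : Prop :=
  forall I : nat -> R -> Prop, (forall k, is_ideal (I k)) ->
    (forall k x, I k x -> I k.+1 x) ->
    exists N, forall k x, (N <= k)%N -> I k x -> I N x.

(* Z[1/p, zeta_p]-algebra structure on R and the character psi_R.
   A ring map Z[1/p,zeta_p] -> R is the same as: p invertible in R and
   an element zeta of R (the image of zeta_p) with Phi_p(zeta) = 0.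
   A nontrivial character psi : (F_q,+) -> Z[1/p,zeta_p]^x takes values
   in mu_p = <zeta_p>, so psi a = zeta_p ^ (f a) for a nonzero additive
   f : F_q -> F_p; psi_R is then a |-> zeta ^ (f a).                     *)
Definition Zp_zeta_data (F : finFieldType) (R : comNzRingType) (p : nat)
    (zeta : R) (f : F -> 'F_p) : Prop :=
  [/\ prime p, p \in [pchar F], (exists y : R, p%:R * y = 1) &
      \sum_(i < p) zeta ^+ i = 0] /\
  ((forall a b, f (a + b) = f a + f b) /\ exists a, f a != 0).

Definition psiR (F : finFieldType) (R : comNzRingType) (p : nat)
    (zeta : R) (f : F -> 'F_p) : F -> R :=
  fun a => zeta ^+ val (f a).

Definition psiR_inv (F : finFieldType) (R : comNzRingType) (p : nat)
    (zeta : R) (f : F -> 'F_p) : F -> R :=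
  fun a => psiR zeta f (- a).

Section Groups.
Variables (F : finFieldType) (R : comNzRingType) (n : nat).

Definition is_N (u : 'M[F]_n) : bool :=
  [forall i : 'I_n, u i i == 1] && [forall i : 'I_n, forall j : 'I_n, (j < i)%N ==> (u i j == 0)].

(* U_m = {(I_{m-1} y; 0 1)} embedded in G_n (m <= n) as diag(U_m, I_{n-m}) *)
Definition is_U (m : nat) (u : 'M[F]_n) : bool :=
  [forall i : 'I_n, u i i == 1] &&
  [forall i : 'I_n, forall j : 'I_n, ((i != j) && ~~ ((j == m.-1 :> nat) && (i < m.-1)%N))
                        ==> (u i j == 0)].

Definition is_block (t : nat) (h : 'M[F]_n) : bool :=
  (h \in unitmx) &&
  [forall i : 'I_n, forall j : 'I_n, ((t <= i)%N || (t <= j)%N) ==> (h i j == (i == j)%:R)].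

Definition chiN (chi : F -> R) (u : 'M[F]_n) : R :=
  chi (\sum_(i < n) \sum_(j < n | (j : nat) == i.+1) u i j).

Definition eta : 'rV[F]_n := \row_(j < n) (if (j : nat).+1 == n then 1 else 0).

Definition Nset : {set 'M[F]_n} := [set u | is_N u].
Definition Gset : {set 'M[F]_n} := [set g | g \in unitmx].
Definition Ncosets : {set {set 'M[F]_n}} :=
  [set [set u *m g | u in Nset] | g in Gset].
End Groups.

Definition in_span (R : comNzRingType) (V : lmodType R) (S : V -> Prop) (x : V)
  : Prop :=
  exists (k : nat) (c : 'I_k -> R) (v : 'I_k -> V),
    (forall i, S (v i)) /\ x = \sum_(i < k) c i *: v i.

Definition is_rep (F : finFieldType) (R : comNzRingType) (n : nat)
    (V : lmodType R) (rho : 'M[F]_n -> V -> V) : Prop :=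
  [/\ (forall g, g \in unitmx -> forall a x y,
          rho g (a *: x + y) = a *: rho g x + rho g y),
      (forall v, rho 1%:M v = v) &
      (forall g h v, g \in unitmx -> h \in unitmx ->
          rho (g *m h) v = rho g (rho h v))].

(* lam : V -> R is R-linear, surjective, and its kernel is exactly the
   submodule <u v - chi(u) v>_{u in N_n}; i.e. lam induces an isomorphism
   V^{(n)} ~ R (so V is of Whittaker type w.r.t. chi) and lam is
   (the pull-back to V of) a generator of Hom_R(V^{(n)}, R).            *)
Definition whittaker_functional (F : finFieldType) (R : comNzRingType) (n : nat)
    (V : lmodType R) (chi : F -> R) (rho : 'M[F]_n -> V -> V) (lam : V -> R)
  : Prop :=
  [/\ (forall a x y, lam (a *: x + y) = a * lam x + lam y),
      (exists v, lam v = 1) &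
      (forall v, lam v = 0 <->
         in_span (fun w => exists u v0, is_N u /\ w = rho u v0 - chiN chi u *: v0) v)].

(* Functions G_n -> R (extended by 0 to non-invertible matrices) and
   functions F^n -> R. *)
Notation WF F R n := {ffun 'M[F]_n -> R^o}.
Notation CF F R n := {ffun 'rV[F]_n -> R^o}.

Definition rt (F : finFieldType) (R : comNzRingType) (n : nat)
    (g : 'M[F]_n) (W : WF F R n) : WF F R n := [ffun x => W (x *m g)].
Definition actC (F : finFieldType) (R : comNzRingType) (n : nat)
    (g : 'M[F]_n) (Phi : CF F R n) : CF F R n := [ffun x => Phi (x *m g)].

Definition whittaker_model (F : finFieldType) (R : comNzRingType) (n : nat)
    (V : lmodType R) (rho : 'M[F]_n -> V -> V) (lam : V -> R) (W : WF F R n)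
  : Prop :=
  exists v, forall g, W g = if g \in unitmx then lam (rho g v) else 0.

(* Generators of the submodule S with Wm^{(n-t)} = Wm / S, for 1 <= t <= n:
   Wm^{(n-t)} = Psi^- (Phi^-)^{n-t-1} Wm is the quotient of Wm by the span
   of u.W - chi(u) W (u in U_m, t+1 < m <= n) and u.W - W (u in U_{t+1});
   for t = n both families are empty (Wm^{(0)} = Wm).                    *)
Definition der_gens (F : finFieldType) (R : comNzRingType) (n : nat)
    (chi : F -> R) (Wm : WF F R n -> Prop) (t : nat) (x : WF F R n) : Prop :=
  exists (m : nat) (u : 'M[F]_n) (W : WF F R n),
    [/\ Wm W, (m <= n)%N, is_U m u &
        ((t.+1 < m)%N /\ x = rt u W - chiN chi u *: W
         \/ m = t.+1 /\ x = rt u W - W)].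

Definition bilinear_on (F : finFieldType) (R : comNzRingType) (n : nat)
    (Wm Wm' : WF F R n -> Prop) (B : WF F R n -> WF F R n -> R) : Prop :=
  (forall a W1 W2 W', Wm W1 -> Wm W2 -> Wm' W' ->
      B (a *: W1 + W2) W' = a * B W1 W' + B W2 W') /\
  (forall a W W1' W2', Wm W -> Wm' W1' -> Wm' W2' ->
      B W (a *: W1' + W2') = a * B W W1' + B W W2').

(* (V,V') is an exceptional pair: for some 1 <= t <= n there is a nonzero
   G_t-invariant R-bilinear form on Wm^{(n-t)} x Wm'^{(n-t)}, i.e. a
   bilinear form on Wm x Wm' killing the two submodules.                 *)
Definition exceptional (F : finFieldType) (R : comNzRingType) (n : nat)
    (chi chi' : F -> R) (Wm Wm' : WF F R n -> Prop) : Prop :=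
  exists t, (1 <= t <= n)%N /\
  exists B : WF F R n -> WF F R n -> R,
    [/\ bilinear_on Wm Wm' B,
        (forall x W', in_span (der_gens chi Wm t) x -> Wm' W' -> B x W' = 0),
        (forall W x', Wm W -> in_span (der_gens chi' Wm' t) x' -> B W x' = 0),
        (forall h W W', is_block t h -> Wm W -> Wm' W' ->
            B (rt h W) (rt h W') = B W W') &
        exists W W', [/\ Wm W, Wm' W' & B W W' != 0]].

Definition inv_trilinear (F : finFieldType) (R : comNzRingType) (n : nat)
    (Wm Wm' : WF F R n -> Prop) (T : WF F R n -> WF F R n -> CF F R n -> R)
  : Prop :=
  [/\ (forall a W1 W2 W' Phi, Wm W1 -> Wm W2 -> Wm' W' ->
        T (a *: W1 + W2) W' Phi = a * T W1 W' Phi + T W2 W' Phi),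
      (forall a W W1' W2' Phi, Wm W -> Wm' W1' -> Wm' W2' ->
        T W (a *: W1' + W2') Phi = a * T W W1' Phi + T W W2' Phi),
      (forall a W W' Phi1 Phi2, Wm W -> Wm' W' ->
        T W W' (a *: Phi1 + Phi2) = a * T W W' Phi1 + T W W' Phi2) &
      (forall g W W' Phi, g \in unitmx -> Wm W -> Wm' W' ->
        T (rt g W) (rt g W') (actC g Phi) = T W W' Phi)].

Definition Iform (F : finFieldType) (R : comNzRingType) (n : nat)
    (W W' : WF F R n) (Phi : CF F R n) : R :=
  \sum_(C in Ncosets F n)
     (let g := odflt 1%:M [pick x in C] in W g * W' g * Phi (eta F n *m g)).

(* Main.v *)
Require Import Defs.
From HB Require Import structures.
From mathcomp Require Import all_boot all_order all_algebra all_field.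
Set Implicit Arguments. Unset Strict Implicit. Unset Printing Implicit Defensive.
Import GRing.Theory.
Local Open Scope ring_scope.

(* Since the form T(W,W',delta_0) is G_n-invariant, it vanishes by
   non-exceptionality at t = n, so by transitivity T is determined by the
   P_n-invariant form B(W,W') = T(W,W',delta_eta).  Fourier analysis of B along
   U_n (|U_n| is invertible in R) splits B into pieces indexed by the characters
   of U_n.  The trivial character gives a G_{n-1}-invariant form on the
   derivatives, zero by non-exceptionality at t = n-1; all the others are
   G_{n-1}-translates of the (U_n,psi)-piece, which is P_{n-1}-invariant.
   Iterating over n-1, n-2, ... one reaches a form that is (N_n,psi)- and
   (N_n,psi^-1)-equivariant, hence a multiple of W(1)W'(1).  The multiple is read
   off on a psi-eigenvector W_1 of all the U_m with W_1(1) = 1: its support in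
   P_n is N_n, so that I(W_1,W_1',delta_eta) = 1 for every W_1' with W_1'(1) = 1,
   and a trilinear form vanishing at (W_1,W_1',delta_eta) is zero. *)

Notation eta := Defs.eta.

(** * Nontrivial additive characters and their orthogonality relations *)

Section AdditiveCharacter.
Variables (F : finFieldType) (R : comNzRingType).

(** Nontriviality is recorded as a vanishing sum: when R has zero divisors, [chi x != 1] for some
    [x] does not imply it. The last clause allows Fourier inversion. *)
Definition add_char (chi : F -> R) : Prop :=
  [/\ chi 0 = 1, (forall x y, chi (x + y) = chi x * chi y),
      \sum_x chi x = 0 & exists y, #|F|%:R * y = 1 :> R].

Lemma card_field_mul_inj (chi : F -> R) (k : nat) (X : R) :
  add_char chi -> (#|F| ^ k)%:R * X = 0 -> X = 0.
Proof.
case=> _ _ _ [y qy]; elim: k => [|k IH]; first by rewrite expn0 mul1r.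
rewrite expnS natrM -mulrA => H; apply: IH.
by rewrite -[LHS]mul1r -[X in X * _ = _]qy -mulrA mulrCA H mulr0.
Qed.

(** Summing the hypothesis over [t] gives 0 on one side and [#|F| * X] on the other, and [#|F|] is a
    unit. *)
Lemma add_char_fixed0 (chi : F -> R) (X : R) :
  add_char chi -> (forall t, chi t * X = X) -> X = 0.
Proof.
move=> chiP fixX; apply: (card_field_mul_inj (k := 1) chiP).
case: chiP => _ _ chi0 _.
have: \sum_t chi t * X = 0 by rewrite -mulr_suml chi0 mul0r.
by rewrite (eq_bigr _ (fun t _ => fixX t)) sumr_const expn1 mulr_natl.
Qed.

Lemma add_charV (chi : F -> R) x : add_char chi -> chi x * chi (- x) = 1.
Proof. by case=> chi1 chiD _ _; rewrite -chiD subrr. Qed.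

Lemma add_char_opp (chi : F -> R) : add_char chi -> add_char (fun x => chi (- x)).
Proof.
case=> chi1 chiD chi0 q; split; [by rewrite oppr0 | by move=> x y; rewrite opprD chiD | | exact: q].
by rewrite -[RHS]chi0 [RHS](reindex_inj oppr_inj).
Qed.

Lemma char_sum_col (chi : F -> R) k (a : 'rV[F]_k) :
  add_char chi -> a != 0 -> \sum_(y : 'cV_k) chi ((a *m y) 0 0) = 0.
Proof.
move=> chiP /rV0Pn [j aj]; apply: (add_char_fixed0 chiP) => t.
(* Moving [y] by [t / a 0 j] along the [j]-th basis vector multiplies its summand by [chi t], so the
   whole sum is fixed by every [chi t]. *)
rewrite mulr_sumr [RHS](reindex_inj (addrI ((t / a 0 j) *: delta_mx j 0))).
apply: eq_bigr => y _; case: chiP => _ chiD _ _.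
by rewrite mulmxDr [in RHS]mxE chiD -scalemxAr -colE [in RHS]mxE [col _ _ _ _]mxE divfK.
Qed.

Lemma char_sum_row (chi : F -> R) k (y : 'cV[F]_k) :
  add_char chi -> y != 0 -> \sum_(a : 'rV_k) chi (- (a *m y) 0 0) = 0.
Proof.
move=> chiP y0; have a0 : - y^T != 0 by rewrite oppr_eq0 trmx_eq0.
rewrite -[RHS](char_sum_col chiP a0).
rewrite (reindex (@trmx F k 1)) /=; last by exists trmx => z _; rewrite trmxK.
by apply: eq_bigr => z _; rewrite mulNmx -[in LHS](trmxK y) -trmx_mul ![in LHS]mxE ![in RHS]mxE.
Qed.

End AdditiveCharacter.

(** Translation shows that the sum S of all values is fixed by every value of the character. Since
    [f] is onto, [zeta ^+ i * S = S] for all [i < p]; adding these up gives [p * S = 0], and p is a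
    unit. *)
Lemma add_char_psiR (F : finFieldType) (R : comNzRingType) (p : nat)
    (zeta : R) (f : F -> 'F_p) :
  Zp_zeta_data zeta f -> add_char (psiR zeta f).
Proof.
case=> -[p_pr pF [y py] sum0] [fD [b fb]].
have zp : zeta ^+ p = 1 by apply/eqP; rewrite -subr_eq0 subrX1 sum0 mulr0.
have f0 : f 0 = 0 by apply: (addrI (f 0)); rewrite -fD !addr0.
have chiD u v : psiR zeta f (u + v) = psiR zeta f u * psiR zeta f v.
  (* Addition in ['F_p] reduces exponents modulo p, which [zeta ^+ p = 1] absorbs. *)
  have zmod i : zeta ^+ (i %% (Zp_trunc (pdiv p)).+2) = zeta ^+ i.
    by rewrite Fp_cast // expr_mod.
  by rewrite /psiR fD /= zmod exprD.
have fMn u i : f (u *+ i) = f u *+ i.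
  by elim: i => [|i IH]; rewrite ?mulr0n // !mulrS fD IH.
split=> //; first by rewrite /psiR f0.
  set S := \sum_x _.
  have fixS t : psiR zeta f t * S = S.
    rewrite mulr_sumr [RHS](reindex_inj (addrI t)).
    by apply: eq_bigr => u _; rewrite chiD.
  suff: p%:R * S = 0.
    by move=> pS; rewrite -[LHS]mul1r -[X in X * _ = _]py -mulrA mulrCA pS mulr0.
  rewrite -[RHS](mul0r S) -[X in _ = X * _]sum0 mulr_suml mulr_natl.
  rewrite -[p in LHS]card_ord -sumr_const.
  (* The multiple of [b] is chosen so that [f] takes the value [i] on it. *)
  apply: eq_bigr => i _; rewrite -{1}(fixS (b *+ (val (i%:R / f b : 'F_p)))).
  congr (_ * _); have natE (w : 'F_p) : (val w)%:R = w := natr_Zp w.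
  rewrite /psiR fMn -[f b *+ _]mulr_natr natE mulrC divfK //.
  by rewrite [val _]val_Fp_nat // modn_small.
have := card_pprimeChar pF; rewrite -[#|_|]/(#|F|) => ->.
exists (y ^+ (logn p #|F|)); rewrite natrX -exprMn_comm ?py ?expr1n //.
exact: mulrC.
Qed.

(** * The groups U_m and N_n, embedded blocks, and the mirabolic decomposition *)

Section Unipotent.
Variable F : finFieldType.

(* The basis vector e_k with 1-based index; it is 0 for k = 0 and for k > n. *)
Definition erow n k : 'rV[F]_n := \row_j ((j : nat).+1 == k)%:R.

(* The element of U_{k+1} with column y above its diagonal entry, embedded in
   G_n; the index is shifted by one from that of U. *)
Definition colU n k (y : 'cV[F]_k) : 'M[F]_n :=
  1%:M + pid_mx k *m y *m erow n k.+1.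
Arguments colU n {k} y.

(** For [k <= n] the rectangular [pid_mx k] truncate, leaving the upper left block; on [is_block k]
    matrices this inverts the embedding of GL_k. *)
Definition corner n k (h : 'M[F]_n) : 'M[F]_k := pid_mx k *m h *m pid_mx k.

Lemma eta_erow n : eta F n = erow n n.
Proof. by apply/rowP=> j; rewrite !mxE; case: eqP. Qed.

Lemma pid_mulE n k (y : 'cV[F]_k) (i : 'I_n) :
  (k <= n)%N -> (pid_mx k *m y) i 0 = if insub (i : nat) is Some l then y l 0 else 0.
Proof.
move=> kn; rewrite mxE; case: insubP => [l _ li|ik].
  rewrite (bigD1 l) //= !mxE li eqxx -li ltn_ord mul1r big1 ?addr0 // => s sl.
  by rewrite !mxE -li (inj_eq val_inj) eq_sym (negPf sl) mul0r.
by rewrite big1 // => s _; rewrite mxE (negPf ik) andbF mul0r.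
Qed.

Lemma pid_mul_ge n k (y : 'cV[F]_k) (i : 'I_n) :
  (k <= i)%N -> (pid_mx k *m y) i 0 = 0.
Proof.
by move=> ki; rewrite mxE big1 // => s _; rewrite mxE ltnNge ki andbF mul0r.
Qed.

Lemma erow_mulE n m k (A : 'M[F]_(n, m)) (i : 'I_n) :
  i.+1 = k -> erow n k *m A = row i A.
Proof.
move=> ik; apply/rowP=> j; rewrite !mxE (bigD1 i) //= mxE ik eqxx mul1r.
by rewrite big1 ?addr0 // => s si; rewrite mxE -ik eqSS (inj_eq val_inj) (negPf si) mul0r.
Qed.

Lemma erow_big n k : (n <= k)%N -> erow n k.+1 = 0.
Proof.
move=> nk; apply/rowP=> j; rewrite !mxE eqSS.
by rewrite (ltn_eqF (leq_trans (ltn_ord j) nk)).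
Qed.

Lemma erow_pid n k m : (k <= n)%N -> (k < m)%N ->
  erow n m *m (pid_mx k : 'M[F]_(n, k)) = 0.
Proof.
move=> kn km; apply/rowP=> j; rewrite !mxE big1 // => s _; rewrite !mxE.
case: eqP => [sm|_]; last by rewrite mul0r.
by rewrite (gtn_eqF (leq_trans (ltn_ord j) _)) ?mulr0 // -ltnS sm.
Qed.

Lemma eta_pid n k : (k <= n)%N -> eta F k *m pid_mx k = erow n k.
Proof.
rewrite eta_erow; case: k => [|k] kn.
  by rewrite pid_mx_0 mulmx0; apply/rowP=> j; rewrite !mxE.
rewrite (erow_mulE _ (i := ord_max)) //; apply/rowP=> j.
by rewrite !mxE /= ltnSn andbT eqSS eq_sym.
Qed.

Lemma blockE n k (h : 'M[F]_n) (i j : 'I_n) :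
  is_block k h -> (k <= i)%N || (k <= j)%N -> h i j = ((i : nat) == j)%:R.
Proof.
case/andP=> _ /forallP hb kij.
by rewrite (eqP (implyP (forallP (hb i) j) kij)) -(inj_eq val_inj).
Qed.

(** The first k columns of a block matrix vanish below row k, so [h] preserves the columns supported
    on the first k coordinates. *)
Lemma corner_mulr n k m (h : 'M[F]_n) (y : 'M[F]_(k, m)) :
  (k <= n)%N -> is_block k h -> h *m (pid_mx k *m y) = pid_mx k *m (corner k h *m y).
Proof.
move=> kn hb.
rewrite /corner !mulmxA pid_mx_id //; congr (_ *m y).
apply/matrixP=> i l; rewrite !mxE.
have -> : \sum_j (pid_mx k *m h) i j * pid_mx k j l
   = \sum_j (if (i < k)%N then h i j else 0) * pid_mx k j l :> F.
  apply: eq_bigr => j _; congr (_ * _); rewrite mxE (bigD1 i) //= mxE eqxx /=.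
  rewrite big1 ?addr0; first by case: ifP; rewrite ?mul1r ?mul0r.
  by move=> s si; rewrite mxE eq_sym (inj_eq val_inj) (negPf si) mul0r.
case: ltnP => // ki; rewrite [RHS]big1 => [|j _]; last by rewrite mul0r.
apply: big1 => j _; rewrite [pid_mx _ _ _]mxE.
case: eqP => [jl|_]; last by rewrite mulr0.
by rewrite (blockE hb) ?ki // (gtn_eqF (leq_trans _ ki)) ?mul0r // jl.
Qed.

Lemma block_erow n k m (h : 'M[F]_n) :
  (k < m)%N -> is_block k h -> erow n m *m h = erow n m.
Proof.
move=> km hb; case: (leqP m n) => [mn|nm].
  case: m km mn => // m km mn.
  rewrite (erow_mulE _ (i := Ordinal mn)) //; apply/rowP=> j; rewrite !mxE.
  by rewrite (blockE hb) /= ?(km : (k <= m)%N) // eqSS eq_sym.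
by case: m nm km => // m nm _; rewrite erow_big // mul0mx.
Qed.

(** GL_k normalises U_{k+1}; this is what makes it act on the characters of U_{k+1}. *)
Lemma block_colU n k (h : 'M[F]_n) (y : 'cV_k) :
  (k <= n)%N -> is_block k h -> h *m colU n y = colU n (corner k h *m y) *m h.
Proof.
move=> kn hb; rewrite /colU mulmxDr mulmx1 mulmxDl mul1mx; congr (_ + _).
by rewrite mulmxA corner_mulr // -!mulmxA (block_erow _ hb).
Qed.

Lemma corner_inj n k (h : 'M[F]_n) :
  (k <= n)%N -> is_block k h -> injective (fun y : 'cV_k => corner k h *m y).
Proof.
move=> kn hb y z /(congr1 (mulmx (pid_mx k : 'M_(n, k)))).
rewrite -!corner_mulr //; case/andP: hb => hu _ /(congr1 (mulmx (invmx h))).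
rewrite !mulKmx // => /(congr1 (mulmx (pid_mx k : 'M_(k, n)))).
by rewrite !mulmxA pid_mx_id // pid_mx_1 !mul1mx.
Qed.

Lemma colU0 n k : colU n (0 : 'cV_k) = 1%:M.
Proof. by rewrite /colU mulmx0 mul0mx addr0. Qed.

Lemma colU_ord0 n (y : 'cV_0) : colU n y = 1%:M.
Proof. by rewrite (flatmx0 y) colU0. Qed.

(** The product of the two nilpotent parts vanishes, because e_{k+1} kills columns supported on the
    first k coordinates. *)
Lemma colUD n k (y z : 'cV_k) : (k <= n)%N -> colU n (y + z) = colU n y *m colU n z.
Proof.
move=> kn; rewrite /colU; set A := pid_mx k *m y *m _; set B := pid_mx k *m z *m _.
have eB : erow n k.+1 *m B = 0 by rewrite /B !mulmxA erow_pid // !mul0mx.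
have AB : A *m B = 0 by rewrite -mulmxA eB mulmx0.
rewrite [RHS]mulmxDl mul1mx [_ *m (1%:M + _)]mulmxDr mulmx1 AB addr0.
by rewrite mulmxDr mulmxDl -/A -/B -addrA [B + A]addrC.
Qed.

Lemma colU_unit n k (y : 'cV_k) : (k <= n)%N -> colU n y \in unitmx.
Proof.
move=> kn; have := colUD y (- y) kn; rewrite subrr colU0 => /esym.
by move/mulmx1_unit => [].
Qed.

Lemma colUE n k (y : 'cV_k) i j :
  colU n y i j = (i == j)%:R + (pid_mx k *m y) i 0 * ((j : nat) == k)%:R.
Proof. by rewrite !mxE big_ord1 !mxE eqSS. Qed.

Lemma colU_block n k m (y : 'cV_k) : (k < m)%N -> (k <= n)%N -> is_block m (colU n y).
Proof.
move=> km kn; rewrite /is_block colU_unit //=; apply/forallP=> i; apply/forallP=> j.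
apply/implyP=> mij; rewrite colUE.
case/orP: mij => [mi|mj]; first by rewrite pid_mul_ge ?mul0r ?addr0 ?(leq_trans (ltnW km)).
by rewrite (gtn_eqF (leq_trans km mj)) mulr0 addr0.
Qed.

Lemma erow_colU n k m (y : 'cV_k) : (k < m)%N -> (k <= n)%N ->
  erow n m *m colU n y = erow n m.
Proof. by move=> km kn; rewrite mulmxDr mulmx1 2!mulmxA erow_pid // !mul0mx addr0. Qed.

Lemma eta_corner n k (h : 'M[F]_n) : (k <= n)%N ->
  erow n k *m h = erow n k -> eta F k *m corner k h = eta F k.
Proof.
move=> kn hk; rewrite /corner !mulmxA eta_pid // hk -(eta_pid kn) -mulmxA.
by rewrite pid_mx_id // pid_mx_1 mulmx1.
Qed.

(** The corner determines the first k entries of the row; the block shape makes the others 0. *)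
Lemma eta_corner_inv n k (h : 'M[F]_n) : (k <= n)%N -> is_block k h ->
  eta F k *m corner k h = eta F k -> erow n k *m h = erow n k.
Proof.
move=> kn hb /(congr1 (mulmxr (pid_mx k : 'M_(k, n)))) /=.
rewrite eta_pid // => {2}<-; rewrite /corner !mulmxA eta_pid // -[in RHS]mulmxA.
rewrite pid_mx_id //.
case: k kn hb => [|k] kn hb.
  rewrite pid_mx_0 mulmx0; apply/rowP=> j; rewrite !mxE big1 // => s _.
  by rewrite mxE mul0r.
apply/rowP=> j; rewrite [RHS]mxE (bigD1 j) //= [pid_mx _ _ _]mxE eqxx.
rewrite big1 ?addr0 => [|s sj]; last by rewrite [pid_mx _ _ _]mxE (inj_eq val_inj) (negPf sj) mulr0.
case: ltnP => [_|kj]; first by rewrite mulr1.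
rewrite mulr0 (erow_mulE _ (i := Ordinal kn)) // mxE.
by rewrite (blockE hb) ?kj ?orbT //= (ltn_eqF kj).
Qed.

(** A nonzero row has rank 1, so elimination writes it as a nonzero scalar times the first row of an
    invertible matrix; a quotient of two such matrices, rescaled, carries [x] to [y]. *)
Lemma GL_transitive k (x y : 'rV[F]_k) : x != 0 -> y != 0 ->
  exists2 g, g \in unitmx & x *m g = y.
Proof.
have decomp (z : 'rV[F]_k) : z != 0 ->
    exists c E, [/\ c != 0, E \in unitmx & z = c *: (pid_mx 1 *m E)].
  move=> z0; exists (col_ebase z 0 0), (row_ebase z).
  have cE : col_ebase z = (col_ebase z 0 0)%:M by apply: mx11_scalar.
  split; last 1 first.
  - rewrite -[LHS]mulmx_ebase rank_rV z0 {1}cE mul_scalar_mx.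
    by rewrite -scalemxAl.
  - by have := col_ebase_unit z; rewrite cE unitmxE det_scalar1 unitfE mxE eqxx mulr1n.
  - exact: row_ebase_unit.
move=> /decomp[cx [Ex [cx0 Exu ->]]] /decomp[cy [Ey [cy0 Eyu ->]]].
exists (invmx Ex *m ((cy / cx) *: Ey)).
  by rewrite unitmx_mul unitmx_inv Exu unitmxZ // unitfE mulf_neq0 ?invr_eq0.
rewrite -scalemxAl !mulmxA mulmxK // -scalemxAr scalerA mulrC divfK //.
Qed.

(** The witness is diag(g, 1), written [top g + copid_mx k]; the same construction on [invmx g] is
    its inverse. *)
Lemma block_embed n k (g : 'M[F]_k) : (k <= n)%N -> g \in unitmx ->
  exists2 h : 'M[F]_n, is_block k h & corner k h = g.
Proof.
move=> kn gu; pose top (g : 'M[F]_k) : 'M[F]_n := pid_mx k *m g *m pid_mx k.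
pose emb g := top g + copid_mx k.
have cp (m : nat) : (pid_mx k : 'M[F]_(m, n)) *m copid_mx k = 0.
  by rewrite /copid_mx mulmxBr mulmx1 pid_mx_id // subrr.
have pc (m : nat) : copid_mx k *m (pid_mx k : 'M[F]_(n, m)) = 0.
  by rewrite /copid_mx mulmxBl mul1mx pid_mx_id // subrr.
have pp : (pid_mx k : 'M[F]_(k, n)) *m pid_mx k = 1%:M by rewrite pid_mx_id // pid_mx_1.
exists (emb g); last first.
  by rewrite /corner /emb /top mulmxDr cp addr0 !mulmxA pp mul1mx -mulmxA pp mulmx1.
apply/andP; split.
  have: emb g *m emb (invmx g) = 1%:M.
    rewrite /emb mulmxDl 2![_ *m (_ + copid_mx k)]mulmxDr copid_mx_id //.
    have -> : top g *m top (invmx g) = pid_mx k.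
      rewrite /top -!mulmxA (mulmxA (pid_mx k : 'M_(k, n))) pp mul1mx.
      by rewrite (mulmxA g) mulmxV // mul1mx pid_mx_id.
    have -> : top g *m copid_mx k = 0 by rewrite /top -mulmxA cp mulmx0.
    have -> : copid_mx k *m top (invmx g) = 0 by rewrite /top !mulmxA pc !mul0mx.
    rewrite addr0 add0r.
    by rewrite /copid_mx addrC subrK.
  by move/mulmx1_unit => [].
apply/forallP=> i; apply/forallP=> j; apply/implyP=> kij.
rewrite /emb /top mxE; set X := (X in X + _); have -> : X = 0.
  rewrite /X -mulmxA; case/orP: kij => [ki|kj].
    by rewrite mxE big1 // => s _; rewrite mxE ltnNge ki andbF mul0r.
  rewrite mulmxA mxE big1 // => s _; rewrite [pid_mx _ _ _]mxE.
  by rewrite (ltn_eqF (leq_trans (ltn_ord s) kj)) mulr0.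
rewrite add0r !mxE; have -> : ((i : nat) == j) && (i < k)%N = false.
  by apply/andP=> -[/eqP ij ik]; move: kij; rewrite -ij orbb leqNgt ik.
by rewrite subr0.
Qed.

Lemma is_U_colU n m (u : 'M[F]_n) : (m < n)%N -> is_U m.+1 u ->
  exists y : 'cV_m, u = colU n y.
Proof.
move=> mn /andP[/forallP u1 /forallP u0].
exists (\col_i u (widen_ord (ltnW mn) i) (Ordinal mn)).
apply/matrixP=> i j; rewrite colUE; have [->|ij] := eqVneq i j.
  rewrite (eqP (u1 j)); case: eqP => [jm|_]; last by rewrite mulr0 addr0.
  by rewrite pid_mul_ge ?jm // mul0r addr0.
rewrite add0r; case: eqP => [jm|/eqP jm]; last first.
  by have /implyP/(_ _)/eqP-> := forallP (u0 i) j; rewrite ?mulr0 // ij /= (negPf jm).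
rewrite mulr1; case: (ltnP i m) => im.
  rewrite pid_mulE 1?ltnW // insubT mxE; congr (u _ _); exact: val_inj.
rewrite pid_mul_ge //.
by have /implyP/(_ _)/eqP-> := forallP (u0 i) j; rewrite // ij /= (ltnNge i) im andbF.
Qed.

Lemma block_peel n k (g : 'M[F]_n) : (k < n)%N -> is_block k.+1 g ->
  erow n k.+1 *m g = erow n k.+1 ->
  exists (y : 'cV_k) (h : 'M[F]_n), is_block k h /\ g = colU n y *m h.
Proof.
move=> kn gb gk; set y : 'cV_k := \col_i g (widen_ord (ltnW kn) i) (Ordinal kn).
exists y, (colU n (- y) *m g); split; last first.
  by rewrite mulmxA -colUD 1?ltnW // subrr colU0 mul1mx.
have gu : g \in unitmx by case/andP: gb.
apply/andP; split; first by rewrite unitmx_mul colU_unit 1?ltnW.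
have hE i j : (colU n (- y) *m g) i j = g i j - (pid_mx k *m y) i 0 * ((j : nat) == k)%:R.
  by rewrite mulmxDl mul1mx -mulmxA gk mulmxN mulNmx !mxE big_ord1 !mxE eqSS.
have rk j : g (Ordinal kn) j = (Ordinal kn == j)%:R.
  have /rowP/(_ j) := gk; rewrite (erow_mulE _ (i := Ordinal kn)) // !mxE => ->.
  by rewrite eqSS eq_sym.
apply/forallP=> i; apply/forallP=> j; apply/implyP=> kij; rewrite hE -(inj_eq val_inj).
case: (ltngtP k i) => [ki|ik|ki].
- by rewrite pid_mul_ge 1?ltnW // mul0r subr0 (blockE gb) ?ki.
- have: (k <= j)%N by case/orP: kij => //; rewrite leqNgt ik.
  rewrite leq_eqVlt => /orP[/eqP kj|kj].
    rewrite -kj eqxx mulr1 pid_mulE 1?ltnW // insubT mxE.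
    have -> : g (widen_ord (ltnW kn) (Sub (i : nat) ik)) (Ordinal kn) = g i j.
      by congr (g _ _); apply: val_inj.
    by rewrite subrr /= -kj (ltn_eqF ik).
  by rewrite (gtn_eqF kj) mulr0 subr0 (blockE gb) ?kj ?orbT.
- rewrite pid_mul_ge ?ki // mul0r subr0.
  have -> : i = Ordinal kn by apply: val_inj.
  by rewrite rk.
Qed.

Lemma colU_mulE n k (y : 'cV_k) (h : 'M[F]_n) : is_block k h ->
  colU n y *m h = h + pid_mx k *m y *m erow n k.+1.
Proof. by move=> hb; rewrite mulmxDl mul1mx -!mulmxA (block_erow _ hb). Qed.

(** Left multiplication by [colU n y] alters only entries strictly above the diagonal. *)
Lemma is_N_peel n k (y : 'cV_k) (h : 'M[F]_n) : is_block k h ->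
  is_N (colU n y *m h) = is_N h.
Proof.
move=> hb; have E (i j : 'I_n) : (j <= i)%N -> (colU n y *m h) i j = h i j.
  move=> ji; rewrite colU_mulE // mxE -[RHS]addr0; congr (_ + _).
  rewrite mxE big_ord1 [erow _ _ _ _]mxE eqSS.
  case: eqP => [jk|_]; last by rewrite mulr0.
  by rewrite pid_mul_ge ?mul0r // -jk.
congr (_ && _); apply: eq_forallb => i; first by rewrite E.
by apply: eq_forallb => j; case: ltnP => //= /ltnW/E->.
Qed.

Lemma is_N1 n : is_N (1%:M : 'M[F]_n).
Proof.
apply/andP; split; apply/forallP=> i; first by rewrite mxE eqxx.
by apply/forallP=> j; apply/implyP=> ji; rewrite mxE -(inj_eq val_inj) (gtn_eqF ji).
Qed.

Lemma is_NP n (u : 'M[F]_n) :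
  reflect ((forall i, u i i = 1) /\ (forall i j : 'I_n, (j < i)%N -> u i j = 0)) (is_N u).
Proof.
apply: (iffP andP) => [[/forallP u1 /forallP u0]|[u1 u0]]; split.
- by move=> i; apply/eqP.
- by move=> i j ji; apply/eqP; apply: (implyP (forallP (u0 i) j)).
- by apply/forallP=> i; rewrite u1.
- by apply/forallP=> i; apply/forallP=> j; apply/implyP=> /u0->.
Qed.

Lemma is_N_mul n (u v : 'M[F]_n) : is_N u -> is_N v -> is_N (u *m v).
Proof.
move=> /is_NP[u1 u0] /is_NP[v1 v0]; apply/is_NP; split=> [i|i j ji]; rewrite mxE.
  rewrite (bigD1 i) //= u1 v1 mulr1 big1 ?addr0 // => l li.
  case: (ltngtP l i) => [/u0->|/v0->|/val_inj e]; rewrite ?mul0r ?mulr0 //.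
  by rewrite e eqxx in li.
apply: big1 => l _; case: (ltnP l i) => [/u0->|il]; first by rewrite mul0r.
by rewrite v0 ?mulr0 // (leq_trans ji).
Qed.

Lemma is_N_unit n (u : 'M[F]_n) : is_N u -> u \in unitmx.
Proof.
case/is_NP=> u1 u0; rewrite unitmxE -det_tr det_trig.
  by rewrite big1 ?unitr1 // => i _; rewrite mxE u1.
by apply/is_trig_mxP=> i j ij; rewrite mxE u0.
Qed.

Lemma eta_N n (u : 'M[F]_n) : is_N u -> eta F n *m u = eta F n.
Proof.
case/is_NP=> u1 u0; rewrite eta_erow; case: n u u1 u0 => [|n] u u1 u0.
  by rewrite !(thinmx0).
rewrite (erow_mulE _ (i := ord_max)) //; apply/rowP=> j; rewrite !mxE.
case: (ltngtP j n) => [jn|jn|jn].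
- by rewrite u0 // eqSS (ltn_eqF jn).
- by have := ltn_ord j; rewrite ltnS leqNgt jn.
- have -> : j = ord_max by apply: val_inj.
  by rewrite u1 /= eqxx.
Qed.

Lemma block_full n (h : 'M[F]_n) : is_block n h = (h \in unitmx).
Proof.
rewrite /is_block andbC; case: forallP => // -[] i; apply/forallP=> j.
by apply/implyP; rewrite leqNgt ltn_ord leqNgt ltn_ord.
Qed.

Lemma block0 n (h : 'M[F]_n) : is_block 0 h -> h = 1%:M.
Proof.
by case/andP=> _ /forallP hb; apply/matrixP=> i j; rewrite mxE; apply/eqP/(forallP (hb i)).
Qed.

Lemma block_mono n k m (h : 'M[F]_n) : (k <= m)%N -> is_block k h -> is_block m h.
Proof.
move=> km /andP[hu /forallP hb]; apply/andP; split=> //.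
apply/forallP=> i; apply/forallP=> j; apply/implyP=> mij.
apply: (implyP (forallP (hb i) j)).
by case/orP: mij => /(leq_trans km)->; rewrite ?orbT.
Qed.

Section ChiN.
Variables (R : comNzRingType) (chi : F -> R).
Hypothesis chiP : add_char chi.

Lemma chiN1 n : chiN chi (1%:M : 'M[F]_n) = 1.
Proof.
case: chiP => chi1 _ _ _; rewrite /chiN big1 // => i _; rewrite big1 // => j /eqP ji.
by rewrite mxE -(inj_eq val_inj) /= ji (ltn_eqF (ltnSn i)).
Qed.

(** The only superdiagonal entry that changes is the one in column k+1, by the last coordinate of
    [y], which [eta F k] extracts. For k = 0 there is none, and [eta F 0 *m y] is 0. *)
Lemma chiN_peel n k (y : 'cV_k) (h : 'M[F]_n) : (k < n)%N -> is_block k h ->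
  chiN chi (colU n y *m h) = chi ((eta F k *m y) 0 0) * chiN chi h.
Proof.
move=> kn hb; case: chiP => chi1 chiD _ _; rewrite /chiN -chiD; congr chi.
rewrite colU_mulE // addrC.
under eq_bigr => i _ do [under eq_bigr => j _ do rewrite mxE; rewrite big_split].
rewrite big_split /=; congr (_ + _).
case: k y kn hb => [|k] y kn hb.
  rewrite (flatmx0 y) !mulmx0 mul0mx mxE big1 // => i _.
  by rewrite big1 // => j _; rewrite mxE.
have kn' := ltnW kn.
rewrite (bigD1 (Ordinal kn')) //= [X in _ + X]big1 ?addr0; last first.
  move=> i ik; rewrite big1 // => j /eqP ji; rewrite mxE big_ord1 [erow _ _ _ _]mxE ji.
  by rewrite !eqSS -[X in X == k]/(val i) -[k]/(val (Ordinal kn')) (inj_eq val_inj) (negPf ik) mulr0.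
rewrite (bigD1 (Ordinal kn)) //= [X in _ + X]big1 ?addr0; last first.
  move=> j /andP[/eqP jk]; rewrite -(inj_eq val_inj) /= jk eqxx.
  by [].
rewrite mxE big_ord1 [erow _ _ _ _]mxE /= eqxx mulr1 pid_mulE 1?ltnW // insubT /= => [|ltk].
  exact: ltnSn.
by rewrite eta_erow (erow_mulE _ (i := ord_max)) // mxE; congr (y _ _); apply: val_inj.
Qed.

Lemma chiN_colU n k (y : 'cV_k) : (k < n)%N ->
  chiN chi (colU n y) = chi ((eta F k *m y) 0 0).
Proof.
move=> kn; rewrite -[colU n y]mulmx1 chiN_peel // ?chiN1 ?mulr1 //.
apply/andP; split; first exact: unitmx1.
by apply/forallP=> i; apply/forallP=> j; rewrite mxE eqxx implybT.
Qed.

End ChiN.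
End Unipotent.
Arguments colU {F} n {k} y.
Arguments erow {F} n k.

(** * Whittaker models, their eigenvectors, and uniqueness of the Whittaker functional *)

Section WhittakerSpaces.
Variables (F : finFieldType) (R : comNzRingType) (n : nat).
Implicit Types (Wm : WF F R n -> Prop) (W : WF F R n).

Lemma rt1 W : rt 1%:M W = W.
Proof. by apply/ffunP=> x; rewrite ffunE mulmx1. Qed.

Lemma rtM g h W : rt (g *m h) W = rt g (rt h W).
Proof. by apply/ffunP=> x; rewrite !ffunE mulmxA. Qed.

Lemma rtP g a W1 W2 : rt g (a *: W1 + W2) = a *: rt g W1 + rt g W2.
Proof. by apply/ffunP=> x; rewrite !ffunE. Qed.

Definition lin_closed (V : lmodType R) (P : V -> Prop) : Prop :=
  forall a x y, P x -> P y -> P (a *: x + y).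

Lemma in_span_ind (V : lmodType R) (S K : V -> Prop) x :
  K 0 -> lin_closed K -> (forall y, S y -> K y) -> in_span S x -> K x.
Proof.
move=> K0 Klin SK [k [c [v [Sv ->]]]].
by elim/big_rec: _ => // i y _ Ky; apply: Klin => //; apply: SK.
Qed.

Lemma lin_closed0 (V : lmodType R) (P : V -> Prop) x : lin_closed P -> P x -> P 0.
Proof. by move=> Pl Px; have := Pl (-1) _ _ Px Px; rewrite scaleN1r addNr. Qed.

Lemma lin_closed_sum (V : lmodType R) (P : V -> Prop) (I : finType) (c : I -> R) (v : I -> V) :
  lin_closed P -> P 0 -> (forall i, P (v i)) -> P (\sum_i c i *: v i).
Proof. by move=> Pl P0 Pv; elim/big_rec: _ => // i y _; apply: Pl. Qed.

(** Since [phi] is linear on [P] only, the induction over the span carries membership in [P] along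
    with vanishing. *)
Lemma span_vanish (V : lmodType R) (P S : V -> Prop) (phi : V -> R) x :
  lin_closed P -> (exists y, P y) ->
  (forall a y z, P y -> P z -> phi (a *: y + z) = a * phi y + phi z) ->
  (forall y, S y -> P y /\ phi y = 0) -> in_span S x -> phi x = 0.
Proof.
move=> Pl [y0 Py0] phil Sphi xS; have P0 := lin_closed0 Pl Py0.
suff [] : P x /\ phi x = 0 by [].
apply: (in_span_ind (K := fun x => P x /\ phi x = 0)) Sphi xS; last first.
  move=> a y z [Py fy] [Pz fz]; split; first exact: Pl.
  by rewrite phil // fy fz mulr0 addr0.
split=> //; have := phil (-1) _ _ P0 P0.
by rewrite scaleN1r addNr mulN1r addNr.
Qed.

(* The last two clauses say that W |-> W(1) identifies the
   (N_n, chi)-coinvariants with R. *)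
Definition whittaker_space (chi : F -> R) Wm : Prop :=
  [/\ lin_closed Wm,
      (forall g W, g \in unitmx -> Wm W -> Wm (rt g W)),
      (forall u g W, is_N u -> Wm W -> W (u *m g) = chiN chi u * W g),
      (exists W, Wm W /\ W 1%:M = 1) &
      (forall W, Wm W -> W 1%:M = 0 ->
         in_span (fun x => exists u W0, [/\ is_N u, Wm W0 & x = rt u W0 - chiN chi u *: W0]) W)].

(** The map [Wv] is linear, equivariant, and satisfies [Wv v 1 = lam v]; hence it carries a
    combination witnessing [lam v = 0] to one for the last clause. *)
Lemma whittaker_modelP (V : lmodType R) (chi : F -> R) (rho : 'M[F]_n -> V -> V) (lam : V -> R) :
  is_rep rho -> whittaker_functional chi rho lam -> whittaker_space chi (whittaker_model rho lam).
Proof.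
move=> [rhoL rho1 rhoM] [lamL [v1 lamv1] lamK].
pose Wv v : WF F R n := [ffun g => if g \in unitmx then lam (rho g v) else 0].
have WvP v : whittaker_model rho lam (Wv v) by exists v => g; rewrite ffunE.
have Wm_Wv W : whittaker_model rho lam W -> exists v, W = Wv v.
  by case=> v Wv'; exists v; apply/ffunP=> g; rewrite ffunE.
have WvL a v w : Wv (a *: v + w) = a *: Wv v + Wv w.
  apply/ffunP=> g; rewrite !ffunE; case: ifP => gu; first by rewrite rhoL // lamL.
  by rewrite /= scaler0 addr0.
have Wvrt g v : g \in unitmx -> rt g (Wv v) = Wv (rho g v).
  move=> gu; apply/ffunP=> x; rewrite !ffunE unitmx_mul gu andbT.
  by case: ifP => // xu; rewrite rhoM.
have lam0 : lam 0 = 0.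
  by have := lamL (-1) 0 0; rewrite scaler0 addr0 mulN1r addNr.
have Wv0 : Wv 0 = 0.
  by have := WvL (-1) 0 0; rewrite scaler0 addr0 scaleN1r addNr.
(* The difference is [lam] of a generator of its own kernel, a span with a single term. *)
have lamN u v : is_N u -> lam (rho u v) = chiN chi u * lam v.
  move=> uN; apply/eqP; rewrite -subr_eq0; apply/eqP.
  have <- : lam (rho u v - chiN chi u *: v) = lam (rho u v) - chiN chi u * lam v.
    by rewrite addrC -scaleNr lamL addrC mulNr.
  apply/lamK; exists 1%N, (fun=> 1), (fun=> rho u v - chiN chi u *: v).
  by rewrite big_ord1 scale1r; split=> // _; exists u, v.
split.
- by move=> a _ _ /Wm_Wv[v ->] /Wm_Wv[w ->]; rewrite -WvL.
- by move=> g _ gu /Wm_Wv[v ->]; rewrite Wvrt.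
- move=> u g _ uN /Wm_Wv[v ->]; rewrite !ffunE unitmx_mul is_N_unit //=.
  case: ifP => [gu|_]; last by rewrite mulr0.
  by rewrite rhoM ?(is_N_unit uN) // lamN.
- by exists (Wv v1); split=> //; rewrite ffunE unitmx1 rho1.
move=> _ /Wm_Wv[v ->]; rewrite ffunE unitmx1 rho1 => /lamK.
case=> k [c [w [wS ->]]].
have WvSum : Wv (\sum_(i < k) c i *: w i) = \sum_(i < k) c i *: Wv (w i).
  by elim/big_rec2: _ => // i x y _ <-; rewrite WvL.
exists k, c, (fun i => Wv (w i)); split=> // i.
have [u [v0 [uN ->]]] := wS i; exists u, (Wv v0); split=> //.
by rewrite Wvrt ?is_N_unit // addrC -scaleNr WvL scaleNr addrC.
Qed.

Section OneSpace.
Variables (chi : F -> R) (Wm : WF F R n -> Prop).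
Hypotheses (chiP : add_char chi) (WmP : whittaker_space chi Wm).

Lemma Wm_colU k (y : 'cV_k) W : (k <= n)%N -> Wm W -> Wm (rt (colU n y) W).
Proof. by case: WmP => _ Wrt _ _ _ kn; apply: Wrt; apply: colU_unit. Qed.

Definition colU_eigen W : Prop := forall k (y : 'cV_k), (k < n)%N ->
  rt (colU n y) W = chi ((eta F k *m y) 0 0) *: W.

Lemma colU_is_N k (y : 'cV[F]_k) : is_N (colU n y).
Proof.
rewrite -[colU n y]mulmx1 is_N_peel ?is_N1 //; apply/andP; split; first exact: unitmx1.
by apply/forallP=> i; apply/forallP=> j; rewrite mxE eqxx implybT.
Qed.

(* Moving U_{j+1} past the smaller group U_{k+1} changes its element but
   not the value of the character on it. *)
Lemma colU_comm k j (y : 'cV[F]_k) (z : 'cV[F]_j) : (k < j)%N -> (j <= n)%N ->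
  exists2 z' : 'cV_j, colU n y *m colU n z = colU n z' *m colU n y
    & (eta F j *m z' = eta F j *m z).
Proof.
move=> kj jn; have kn := leq_trans (ltnW kj) jn.
exists (corner j (colU n y) *m z).
  by rewrite block_colU // colU_block.
by rewrite mulmxA eta_corner // erow_colU.
Qed.

(** Start from any W with W(1) = 1 and project onto the [chi]-eigenspace of U_{k+1} for k = n-1,
    n-2, ..., 0. Each projection preserves the earlier eigenproperties by [colU_comm]. *)
Lemma exists_eigen : exists W, [/\ Wm W, W 1%:M = 1 & colU_eigen W].
Proof.
case: (WmP) => Wl Wrt WN [W0 [W0m W01]] _.
suff /(_ n) [W [Wm1 W1 We]]: forall d, exists W, [/\ Wm W, W 1%:M = 1 &
    forall k (y : 'cV_k), (n - d <= k < n)%N ->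
      rt (colU n y) W = chi ((eta F k *m y) 0 0) *: W].
  by exists W; split=> // k y kn; apply: We; rewrite subnn.
elim=> [|d [W [Wm1 W1 We]]].
  by exists W0; split=> // k y; rewrite subn0 leqNgt andNb.
(* For [d >= n] the truncated difference [n - d] is 0, so all levels are already treated. *)
case: (ltnP d n) => [dn|nd]; last first.
  exists W; split=> // k y; rewrite (eqP (leqW nd : n - d.+1 == 0)%N) => kn.
  by apply: We; rewrite (eqP (nd : n - d == 0)%N).
set k := (n - d.+1)%N; have kE : (n - d = k.+1)%N by rewrite /k subnSK.
have kn : (k < n)%N by rewrite -kE leq_subr.
have [r rq] : exists r : R, (#|F| ^ k)%:R * r = 1.
  case: chiP => _ _ _ [r rq]; exists (r ^+ k).
  by rewrite natrX -exprMn_comm ?rq ?expr1n //; apply: mulrC.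
(* With [r] the inverse of |U_{k+1}|, [r *: S] is the projection of [W]. *)
pose S := \sum_(y : 'cV_k) chi (- (eta F k *m y) 0 0) *: rt (colU n y) W.
have Sm : Wm S.
  apply: lin_closed_sum => //; first exact: (lin_closed0 Wl Wm1).
  by move=> y; apply: Wm_colU => //; apply: ltnW.
have rtS g : rt g S = \sum_(y : 'cV_k) chi (- (eta F k *m y) 0 0) *: rt g (rt (colU n y) W).
  rewrite /S; elim/big_rec2: _ => [|y A B _ <-]; last exact: rtP.
  by apply/ffunP=> x; rewrite !ffunE.
exists (r *: S); split.
- by rewrite -[r *: S]addr0; exact: (Wl _ _ _ Sm (lin_closed0 Wl Wm1)).
(* Left equivariance of [W] cancels the weight, so every summand takes the value 1 at the
   identity. *)
- rewrite ffunE sum_ffunE (eq_bigr (fun=> 1)); last first.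
    move=> y _; rewrite !ffunE mul1mx -[colU n y]mulmx1 WN ?colU_is_N // chiN_colU //.
    by rewrite W1 mulr1 [LHS]mulrC (add_charV _ chiP).
  by rewrite sumr_const card_mx muln1 -mulr_natr mul1r -[RHS]rq mulrC.
- move=> j z /andP[kj jn].
  have -> : rt (colU n z) (r *: S) = r *: rt (colU n z) S.
    by apply/ffunP=> x; rewrite !ffunE.
  rewrite scalerA [_ * r]mulrC -scalerA; congr (_ *: _); rewrite rtS scaler_sumr.
  move: kj; rewrite leq_eqVlt => /orP[/eqP kj|kj].
    subst j; rewrite [RHS](reindex_inj (addrI z)); apply: eq_bigr => y _.
    case: chiP => _ chiD _ _.
    rewrite -rtM -colUD 1?ltnW // scalerA -chiD mulmxDr.
    by rewrite [(_ + _ : 'M_1) 0 0]mxE opprD addrA subrr add0r.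
  apply: eq_bigr => y _; have [z' zE ze] := colU_comm (- y) z kj (ltnW jn).
  have -> : rt (colU n z) (rt (colU n y) W) = rt (colU n y) (rt (colU n z') W).
    rewrite -!rtM; congr (rt _ W).
    have kn' := ltnW kn.
    have: colU n y *m (colU n (- y) *m colU n z) *m colU n y
        = colU n y *m (colU n z' *m colU n (- y)) *m colU n y by rewrite zE.
    rewrite !mulmxA -colUD // subrr colU0 mul1mx => ->.
    by rewrite -mulmxA -colUD // addNr colU0 mulmx1.
  rewrite We ?jn ?kE ?kj // ze.
  have rtZ g a X : rt g (a *: X) = a *: rt g X by apply/ffunP=> x; rewrite !ffunE.
  by rewrite rtZ !scalerA mulrC.
Qed.

(* For g in P_n of the form diag(A, 1) with A in GL_k, comparing the actions
   of U_{k+1} on both sides of g forces W(g) = 0 unless the last row of A is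
   (0,...,0,1); this is then repeated with k - 1. *)
Lemma eigen_support k g W : Wm W -> colU_eigen W -> (k <= n)%N ->
  is_block k g -> erow n k *m g = erow n k -> W g != 0 -> is_N g.
Proof.
move=> Wm1 We; elim: k g => [|k IH] g kn gb gk Wg.
  by rewrite (block0 gb) is_N1.
have [y [h [hb gE]]] := block_peel kn gb gk.
rewrite gE is_N_peel //.
case: (WmP) => _ _ WN _ _.
have Wh : W h != 0.
  by apply: contraNneq Wg => Wh; rewrite gE WN ?colU_is_N // Wh mulr0.
have kn' := ltnW kn.
apply: IH => //; apply: eta_corner_inv => //; apply/eqP; rewrite -subr_eq0.
apply: contraNT Wh => d0; apply/eqP; apply: (card_field_mul_inj (k := k) chiP).
have : \sum_(z : 'cV_k) chi (((eta F k *m corner k h - eta F k) *m z) 0 0) * W h = 0.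
  by rewrite -mulr_suml char_sum_col // mul0r.
rewrite (eq_bigr (fun=> W h)) ?sumr_const ?card_mx ?muln1 ?mulr_natl // => z _.
have := We k z kn => /ffunP/(_ h); rewrite !ffunE block_colU // WN ?colU_is_N //.
rewrite chiN_colU // mulmxA => E; rewrite mulmxBl [(_ - _ : 'M_1) 0 0]mxE.
case: (chiP) => _ -> _ _; rewrite mulrAC E [(- _ : 'M_1) _ _]mxE [LHS]mulrAC.
by rewrite (add_charV _ chiP) mul1r.
Qed.

(** Peeling off one U_{k+1} at a time makes [phi] equivariant under all of N_n. It then kills the
    kernel of evaluation at 1, which contains [W - W(1) W1]. *)
Lemma eigenfunctional_unique (phi : WF F R n -> R) W1 W :
  (forall a X Y, Wm X -> Wm Y -> phi (a *: X + Y) = a * phi X + phi Y) ->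
  (forall k (y : 'cV_k) X, (0 < k < n)%N -> Wm X ->
     phi (rt (colU n y) X) = chi ((eta F k *m y) 0 0) * phi X) ->
  Wm W1 -> W1 1%:M = 1 -> Wm W -> phi W = W 1%:M * phi W1.
Proof.
move=> phil phiU m1 e1 m; case: (WmP) => Wl Wrt _ _ Wk.
have phiN k (u : 'M_n) X : is_block k u -> is_N u -> (k <= n)%N -> Wm X ->
   phi (rt u X) = chiN chi u * phi X.
  elim: k u X => [|k IH] u X ub uN kn mX.
    by rewrite (block0 ub) rt1 (chiN1 chiP) mul1r.
  have uk : erow n k.+1 *m u = erow n k.+1.
    rewrite (erow_mulE _ (i := Ordinal kn)) //; apply/rowP=> j; rewrite !mxE.
    case/is_NP: uN => u1 u0; case: (ltngtP j k) => jk.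
    - by rewrite u0 // eqSS (ltn_eqF jk).
    - by rewrite (blockE ub) ?ltnS ?jk ?orbT //= eqSS eq_sym.
    - have -> : j = Ordinal kn by apply: val_inj.
      by rewrite u1 /= eqxx.
  have [y [h [hb uE]]] := block_peel kn ub uk.
  have hN : is_N h by rewrite -(is_N_peel y hb) -uE.
  have mh : Wm (rt h X) by apply: Wrt => //; apply: is_N_unit.
  rewrite uE rtM (chiN_peel chiP) // -mulrA -(IH h X) 1?ltnW //.
  (* U_1 is trivial, so the level k = 0, outside the range of [phiU], is checked directly. *)
  case: k y {hb uk ub uE IH} kn => [|k] y kn; last by rewrite phiU.
  rewrite colU_ord0 rt1 (flatmx0 y) mulmx0 mxE; case: chiP => -> _ _ _.
  by rewrite mul1r.
apply/eqP; rewrite -subr_eq0; apply/eqP.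
have -> : phi W - W 1%:M * phi W1 = phi (- W 1%:M *: W1 + W).
  by rewrite phil // mulNr addrC.
apply: (span_vanish (P := Wm) (phi := phi)) (Wk _ _ _) => //.
- by exists W.
- move=> _ [u [X [uN mX ->]]].
  have muX : Wm (rt u X) by apply: Wrt => //; apply: is_N_unit.
  rewrite addrC -scaleNr; split; first exact: Wl.
  rewrite phil // (phiN n) ?block_full ?is_N_unit //.
  by rewrite mulNr addNr.
- exact: Wl.
- by rewrite !ffunE e1 -[_ *: _]/(_ * _) mulr1 addNr.
Qed.

End OneSpace.

End WhittakerSpaces.

(** * Fourier analysis of mirabolic-invariant pairings *)

Section Forms.
Variables (F : finFieldType) (R : comNzRingType) (n : nat) (chi : F -> R).
Hypothesis chiP : add_char chi.
Let chi' x := chi (- x).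
Variables Wm Wm' : WF F R n -> Prop.
Hypotheses (WmP : whittaker_space chi Wm) (WmP' : whittaker_space chi' Wm').
Implicit Types (W : WF F R n) (B : WF F R n -> WF F R n -> R).

(* Invariance under P_{k+1}, which is generated by GL_k and U_{k+1}, together
   with (U_{j+1}, chi)-equivariance for j > k: a P_{k+1}-invariant pairing of
   the images of Wm and Wm' under (Phi^-)^{n-k-1}. *)
Definition mirabolic_form k B : Prop :=
  [/\ bilinear_on Wm Wm' B,
      (forall h W W', is_block k h -> Wm W -> Wm' W' -> B (rt h W) (rt h W') = B W W'),
      (forall (y : 'cV_k) W W', Wm W -> Wm' W' ->
         B (rt (colU n y) W) (rt (colU n y) W') = B W W'),
      (forall j (y : 'cV_j) W W', (k < j < n)%N -> Wm W -> Wm' W' ->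
         B (rt (colU n y) W) W' = chi ((eta F j *m y) 0 0) * B W W') &
      (forall j (y : 'cV_j) W W', (k < j < n)%N -> Wm W -> Wm' W' ->
         B W (rt (colU n y) W') = chi' ((eta F j *m y) 0 0) * B W W')].

(* Up to the factor q^k, the part of B on which U_{k+1} acts through
   y |-> chi(a y) in the first variable. *)
Definition twist k (a : 'rV[F]_k) B W W' : R :=
  \sum_(y : 'cV_k) chi (- (a *m y) 0 0) * B (rt (colU n y) W) W'.

Section Twist.
Variables (k : nat) (B : WF F R n -> WF F R n -> R).
Hypotheses (kn : (k < n)%N) (BP : mirabolic_form k B).

Let mU (y : 'cV_k) W : Wm W -> Wm (rt (colU n y) W).
Proof. exact: (Wm_colU WmP y (ltnW kn)). Qed.

Lemma twist_bilinear (a : 'rV_k) : bilinear_on Wm Wm' (twist (k := k) a B).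
Proof.
case: BP => -[Bl Br] _ _ _ _; have kn' := ltnW kn; split=> [c W1 W2 W' m1 m2 m'|c W W1 W2 m m1 m2].
  rewrite /twist mulr_sumr -big_split; apply: eq_bigr => y _.
  by rewrite rtP Bl ?mulrDr 1?mulrCA //; apply: mU.
rewrite /twist mulr_sumr -big_split; apply: eq_bigr => y _.
by rewrite Br ?mulrDr 1?mulrCA //; apply: mU.
Qed.

(** Fourier inversion: after exchanging the sums, orthogonality leaves only [y = 0]. *)
Lemma twist_sum W W' : \sum_a twist (k := k) a B W W' = (#|F| ^ k)%:R * B W W'.
Proof.
rewrite exchange_big (bigD1 0) //= [X in _ + X]big1 ?addr0 => [|y y0].
  rewrite colU0 rt1 -mulr_suml; congr (_ * _).
  rewrite (eq_bigr (fun=> 1)) ?sumr_const ?card_mx ?mul1n // => a _.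
  by rewrite mulmx0 mxE oppr0; case: chiP.
by rewrite -mulr_suml char_sum_row // mul0r.
Qed.

Lemma twist_colU_l (a : 'rV_k) (z : 'cV_k) W W' :
  twist a B (rt (colU n z) W) W' = chi ((a *m z) 0 0) * twist a B W W'.
Proof.
case: chiP => _ chiD _ _; have kn' := ltnW kn.
rewrite /twist mulr_sumr [RHS](reindex_inj (addIr z)); apply: eq_bigr => y _.
rewrite -rtM -colUD // mulrA -chiD mulmxDr [(_ + _ : 'M_1) 0 0]mxE.
by rewrite opprD addrCA addrN addr0.
Qed.

(** Diagonal invariance of [B] moves the translation to the first variable with opposite sign, hence
    the inverse character. *)
Lemma twist_colU_r (a : 'rV_k) (z : 'cV_k) W W' : Wm W -> Wm' W' ->
  twist a B W (rt (colU n z) W') = chi' ((a *m z) 0 0) * twist a B W W'.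
Proof.
move=> m m'; case: chiP => _ chiD _ _; have kn' := ltnW kn; case: BP => _ _ BU _ _.
rewrite /twist mulr_sumr [LHS](reindex_inj (addrI z)); apply: eq_bigr => y _.
rewrite colUD // rtM (BU z _ _ (mU y m) m') mulrA -chiD mulmxDr.
by rewrite [(_ + _ : 'M_1) 0 0]mxE opprD.
Qed.

(** Conjugation by GL_k permutes U_{k+1}, hence the Fourier pieces; all nonzero [a] thereby reduce
    to [eta F k]. *)
Lemma twist_block (a : 'rV_k) h W W' : is_block k h -> Wm W -> Wm' W' ->
  twist a B (rt h W) (rt h W') = twist (a *m corner k h) B W W'.
Proof.
move=> hb m m'; have kn' := ltnW kn; case: BP => _ Bh _ _ _.
rewrite /twist (reindex_inj (corner_inj kn' hb)) /=; apply: eq_bigr => y _.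
by rewrite -rtM -block_colU // rtM (Bh h _ _ hb (mU y m) m') mulmxA.
Qed.

Lemma twist_U_l (a : 'rV_k) j (z : 'cV_j) W W' : (k < j < n)%N -> Wm W -> Wm' W' ->
  twist a B (rt (colU n z) W) W' = chi ((eta F j *m z) 0 0) * twist a B W W'.
Proof.
move=> /andP[kj jn] m m'; have kn' := ltnW kn; case: BP => _ _ _ BU _.
rewrite /twist mulr_sumr; apply: eq_bigr => y _.
have [z' E e] := colU_comm y z kj (ltnW jn).
by rewrite -rtM E rtM (BU _ _ _ _ _ (mU y m) m') ?kj // e mulrCA.
Qed.

Lemma twist_U_r (a : 'rV_k) j (z : 'cV_j) W W' : (k < j < n)%N -> Wm W -> Wm' W' ->
  twist a B W (rt (colU n z) W') = chi' ((eta F j *m z) 0 0) * twist a B W W'.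
Proof.
move=> kjn m m'; have kn' := ltnW kn; case: BP => _ _ _ _ BU.
rewrite /twist mulr_sumr; apply: eq_bigr => y _.
by rewrite (BU _ _ _ _ kjn (mU y m) m') mulrCA.
Qed.

Hypothesis nonexc : ~ exceptional chi chi' Wm Wm'.

(** The piece at the trivial character is U_{k+1}-invariant in each variable and [chi]- or
    [chi']-equivariant under the larger U_{j+1}, so it descends to the derivatives with t = k. Being
    GL_k-invariant, it would make the pair exceptional if nonzero. *)
Lemma twist0_eq0 W W' : (0 < k)%N -> Wm W -> Wm' W' -> twist (k := k) 0 B W W' = 0.
Proof.
move=> k0 m m'; apply/eqP; apply: contraT => ne0; case: nonexc.
have [tl tr] := twist_bilinear 0; have kn' := ltnW kn.
have chi00 : chi 0 = 1 by case: chiP.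
have chi'00 : chi' 0 = 1 by rewrite /chi' oppr0.
case: (WmP) (WmP') => Wl Wrt _ _ _ [Wl' Wrt' _ _ _].
exists k; split; first by rewrite k0 ltnW.
exists (twist (k := k) 0 B); split.
- split=> *; [exact: tl | exact: tr].
- move=> x X' xS mX'.
  apply: (span_vanish (P := Wm) (phi := fun x => twist (k := k) 0 B x X')) xS => //.
  + by exists W.
  + by move=> *; apply: tl.
  (* A generator of index [m = j.+1] comes from a [colU] with a column of length [j]; the two
     families are then [k < j] and [j = k]. *)
  move=> z [[|j] [u [X [mX jn uU]]]]; first by case=> -[].
  have [y uE] := is_U_colU jn uU; rewrite uE => H.
  have mu : Wm (rt (colU n y) X) := Wm_colU WmP y (ltnW jn) mX.
  have twN c : twist (k := k) 0 B (rt (colU n y) X - c *: X) X'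
      = twist (k := k) 0 B (rt (colU n y) X) X' - c * twist (k := k) 0 B X X'.
    by rewrite addrC -scaleNr tl // mulNr addrC.
  have clN c : Wm (rt (colU n y) X - c *: X) by rewrite addrC -scaleNr; apply: Wl.
  case: H => -[kj ->].
    have kjn : (k < j < n)%N by apply/andP.
    by split=> //; rewrite twN (twist_U_l _ _ kjn) // (chiN_colU chiP _ jn) subrr.
  case: kj => kj; subst j; split; first by have := clN 1; rewrite scale1r.
  rewrite -[X in _ - X]scale1r twN twist_colU_l mul0mx mxE chi00.
  by rewrite subrr.
- move=> X x' mX xS.
  apply: (span_vanish (P := Wm') (phi := fun x => twist (k := k) 0 B X x)) xS => //.
  + by exists W'.
  + by move=> *; apply: tr.
  move=> z [[|j] [u [X' [mX' jn uU]]]]; first by case=> -[].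
  have [y uE] := is_U_colU jn uU; rewrite uE => H.
  have mu : Wm' (rt (colU n y) X') := Wm_colU WmP' y (ltnW jn) mX'.
  have twN c : twist (k := k) 0 B X (rt (colU n y) X' - c *: X')
      = twist (k := k) 0 B X (rt (colU n y) X') - c * twist (k := k) 0 B X X'.
    by rewrite addrC -scaleNr tr // mulNr addrC.
  have clN c : Wm' (rt (colU n y) X' - c *: X') by rewrite addrC -scaleNr; apply: Wl'.
  case: H => -[kj ->].
    have kjn : (k < j < n)%N by apply/andP.
    split=> //; rewrite twN (twist_U_r _ _ kjn) // (chiN_colU _ _ jn) ?subrr //.
    exact: add_char_opp.
  case: kj => kj; subst j; split; first by have := clN 1; rewrite scale1r.
  rewrite -[X in _ - X]scale1r twN twist_colU_r // mul0mx mxE chi'00.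
  by rewrite subrr.
- by move=> h X X' hb mX mX'; rewrite twist_block // mul0mx.
- by exists W, W'.
Qed.

(** P_k fixes the character [eta F k], so invariance survives under GL_{k-1} and U_k, while U_{k+1}
    now acts through [chi]: one step down the chain of mirabolics. *)
Lemma twist_eta_mirabolic k' : k = k'.+1 -> mirabolic_form k' (twist (eta F k) B).
Proof.
move=> kE; have kn' := ltnW kn; have k'n : (k' < n)%N by rewrite -kE.
have inv h W W' : is_block k h -> erow n k *m h = erow n k -> Wm W -> Wm' W' ->
    twist (eta F k) B (rt h W) (rt h W') = twist (eta F k) B W W'.
  by move=> hb hk m m'; rewrite twist_block // eta_corner.
split.
- exact: twist_bilinear.
- move=> h W W' hb; apply: inv; last by rewrite (block_erow _ hb) // kE.
  by apply: block_mono hb; rewrite kE.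
- move=> y W W'; apply: inv; first by rewrite colU_block ?kE // ltnW.
  by rewrite erow_colU ?kE // ltnW.
- move=> j y W W' /andP[kj jn] m m'; rewrite -kE leq_eqVlt in kj.
  case/orP: kj => [/eqP kj|kj]; last by rewrite twist_U_l ?kj.
  by subst j; rewrite twist_colU_l.
- move=> j y W W' /andP[kj jn] m m'; rewrite -kE leq_eqVlt in kj.
  case/orP: kj => [/eqP kj|kj]; last by rewrite twist_U_r ?kj.
  by subst j; rewrite twist_colU_r.
Qed.

End Twist.

(** At level 0 the form is equivariant in each variable separately, so uniqueness of the Whittaker
    functional applies twice. *)
Lemma mirabolic_form0 B W1 W1' W W' : mirabolic_form 0 B ->
  Wm W1 -> Wm' W1' -> W1 1%:M = 1 -> W1' 1%:M = 1 -> Wm W -> Wm' W' ->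
  B W W' = W 1%:M * W' 1%:M * B W1 W1'.
Proof.
move=> [[Bl Br] _ _ BU BU'] m1 m1' e1 e1' m m'.
rewrite (eigenfunctional_unique chiP WmP (phi := B^~ W') _ _ m1) //.
- rewrite -mulrA; congr (_ * _).
  by apply: (eigenfunctional_unique (add_char_opp chiP) WmP') => // *; [exact: Br | exact: BU'].
- by move=> *; apply: Bl.
- by move=> *; apply: BU.
Qed.

Lemma mirabolic_form_inj k B W1 W1' : ~ exceptional chi chi' Wm Wm' ->
  Wm W1 -> Wm' W1' -> W1 1%:M = 1 -> W1' 1%:M = 1 -> colU_eigen chi W1 ->
  (k < n)%N -> mirabolic_form k B -> B W1 W1' = 0 ->
  forall W W', Wm W -> Wm' W' -> B W W' = 0.
Proof.
move=> nonexc m1 m1' e1 e1' We; elim: k B => [|k IH] B kn BP B1 W W' m m'.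
  by rewrite (mirabolic_form0 BP m1 m1') // B1 mulr0.
have eta0 X X' : Wm X -> Wm' X' -> twist (eta F k.+1) B X X' = 0.
  apply: IH; first exact: ltnW.
    exact: twist_eta_mirabolic kn BP _ _.
  (* As [W1] is an eigenvector, each term is a multiple of [B W1 W1'], so the vanishing at the test
     pair passes down to level k. *)
  rewrite /twist big1 // => y _; rewrite We //.
  case: BP => -[Bl _] _ _ _ _; have W0 : Wm 0 by case: WmP => /lin_closed0/(_ m1).
  have := Bl (chi ((eta F k.+1 *m y) 0 0)) W1 0 W1' m1 W0 m1'.
  have := Bl (-1) 0 0 W1' W0 W0 m1'; rewrite scaler0 addr0 mulN1r addNr => ->.
  by rewrite !addr0 B1 mulr0 => ->; rewrite mulr0.
apply: (card_field_mul_inj (k := k.+1) chiP); rewrite -twist_sum // big1 // => a _.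
have [->|a0] := eqVneq a 0; first by rewrite (twist0_eq0 kn BP).
have eta_n0 : eta F k.+1 != 0.
  apply/rV0Pn; exists ord_max; rewrite mxE /= eqxx; exact: oner_neq0.
have [g gu <-] := GL_transitive eta_n0 a0.
have [h hb <-] := block_embed (ltnW kn) gu.
case: (WmP) (WmP') => _ Wrt _ _ _ [_ Wrt' _ _ _]; have hu : h \in unitmx by case/andP: hb.
by rewrite -(twist_block kn BP) // eta0 //; [apply: Wrt | apply: Wrt'].
Qed.

End Forms.

(** * Sums over N_n\G_n *)

Section CosetSums.
Variables (F : finFieldType) (R : comNzRingType) (n : nat).

Definition Ncoset (g : 'M[F]_n) : {set 'M[F]_n} := [set u *m g | u in Nset F n].

(** The coset contains [g], so the default [1%:M] is never reached. *)
Lemma Ncoset_rep (H : 'M[F]_n -> R) g :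
  (forall u, is_N u -> H (u *m g) = H g) ->
  H (odflt 1%:M [pick x in Ncoset g]) = H g.
Proof.
move=> HN; case: pickP => [x /imsetP[u]|/(_ g)/negP[]] /=.
  by rewrite inE => uN ->; apply: HN.
by apply/imsetP; exists 1%:M; rewrite ?mul1mx // inE is_N1.
Qed.

Lemma Ncoset_N u : is_N u -> Ncoset u = Nset F n.
Proof.
move=> uN; apply/eqP; rewrite eqEcard card_imset; last first.
  by apply: can_inj (mulmxK _) ; apply: is_N_unit.
rewrite leqnn andbT; apply/subsetP=> _ /imsetP[v vN ->].
by rewrite inE in vN; rewrite inE is_N_mul.
Qed.

(** This is [Iform] with its summand abstracted; the two are convertible. *)
Definition Nsum (H : 'M[F]_n -> R) : R :=
  \sum_(C in Ncosets F n) H (odflt 1%:M [pick x in C]).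

(** Right translation permutes the cosets, and N_n-invariance of [H] makes the chosen
    representatives irrelevant. *)
Lemma Nsum_translate (H : 'M[F]_n -> R) g : g \in unitmx ->
  (forall u x, is_N u -> x \in unitmx -> H (u *m x) = H x) ->
  Nsum (fun x => H (x *m g)) = Nsum H.
Proof.
move=> gu HN; pose tr (h : 'M[F]_n) (C : {set 'M[F]_n}) := [set x *m h | x in C].
have trK h : h \in unitmx -> cancel (tr h) (tr (invmx h)).
  move=> hu C; apply/setP=> x; apply/imsetP/idP => [[_ /imsetP[y yC ->] ->]|xC].
    by rewrite mulmxK.
  by exists (x *m h); rewrite ?mulmxK //; apply/imsetP; exists x.
have trN h x : tr h (Ncoset x) = Ncoset (x *m h).
  by rewrite /tr /Ncoset -imset_comp; apply: eq_imset => u /=; rewrite mulmxA.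
have trC h C : h \in unitmx -> C \in Ncosets F n -> tr h C \in Ncosets F n.
  move=> hu /imsetP[x]; rewrite inE => xu ->; apply/imsetP; exists (x *m h).
    by rewrite inE unitmx_mul xu.
  exact: trN.
rewrite /Nsum [RHS](reindex_inj (can_inj (trK g gu))) /=.
apply: eq_big => [C|C /imsetP[x]].
  apply/idP/idP; first exact: trC.
  by move/(trC (invmx g)); rewrite unitmx_inv trK //; apply.
rewrite inE => xu ->; rewrite trN (Ncoset_rep (H := fun y => H (y *m g))).
  by rewrite Ncoset_rep // => u uN; apply: HN; rewrite // unitmx_mul xu.
by move=> u uN; rewrite -mulmxA HN // unitmx_mul xu.
Qed.

Lemma Nsum_supp (H : 'M[F]_n -> R) :
  (forall u x, is_N u -> x \in unitmx -> H (u *m x) = H x) ->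
  (forall x, x \in unitmx -> ~~ is_N x -> H x = 0) -> Nsum H = H 1%:M.
Proof.
move=> HN H0; rewrite /Nsum (bigD1 (Ncoset 1%:M)) /=; last first.
  by apply/imsetP; exists 1%:M; rewrite // inE unitmx1.
rewrite Ncoset_rep => [|u uN]; last by rewrite HN ?unitmx1.
rewrite big1 ?addr0 // => C /andP[/imsetP[x]]; rewrite inE => xu ->.
rewrite -/(Ncoset x) => xN; rewrite Ncoset_rep => [|u uN]; last exact: HN.
apply: H0 => //; apply: contraNN xN => /Ncoset_N->.
by rewrite Ncoset_N ?is_N1.
Qed.

End CosetSums.

(** * Invariant trilinear forms: the form I, and vanishing from a single value *)

Section Trilinear.
Variables (F : finFieldType) (R : comNzRingType) (n : nat) (chi : F -> R).
Hypothesis chiP : add_char chi.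
Let chi' x := chi (- x).
Variables Wm Wm' : WF F R n -> Prop.
Hypotheses (WmP : whittaker_space chi Wm) (WmP' : whittaker_space chi' Wm').
Implicit Types (W : WF F R n) (Phi : CF F R n).

Lemma Iform_summand_N W W' Phi u x : Wm W -> Wm' W' -> is_N u ->
  W (u *m x) * W' (u *m x) * Phi (eta F n *m (u *m x))
  = W x * W' x * Phi (eta F n *m x).
Proof.
move=> m m' uN; case: (WmP) (WmP') => _ _ WN _ _ [_ _ WN' _ _].
rewrite WN // WN' // mulmxA eta_N //; congr (_ * _).
rewrite mulrACA -[RHS]mul1r; congr (_ * _).
exact: add_charV.
Qed.

Lemma Iform_invariant : inv_trilinear Wm Wm' (@Iform F R n).
Proof.
split.
- move=> a W1 W2 W' Phi _ _ _; rewrite /Iform mulr_sumr -big_split.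
  by apply: eq_bigr => C _ /=; rewrite !ffunE !mulrDl !mulrA.
- move=> a W W1 W2 Phi _ _ _; rewrite /Iform mulr_sumr -big_split.
  apply: eq_bigr => C _ /=; rewrite !ffunE -[_ *: _]/(_ * _) mulrDr mulrDl.
  by congr (_ + _); rewrite !mulrA [_ * a]mulrC.
- move=> a W W' Phi1 Phi2 _ _; rewrite /Iform mulr_sumr -big_split.
  apply: eq_bigr => C _ /=; rewrite !ffunE -[_ *: _]/(_ * _) mulrDr.
  by congr (_ + _); rewrite mulrCA.
move=> g W W' Phi gu m m'.
pose H x := W x * W' x * Phi (eta F n *m x).
rewrite -[RHS]/(Nsum H) -(Nsum_translate gu) => [|u x uN _]; last exact: Iform_summand_N.
by apply: eq_bigr => C _; rewrite /H !ffunE mulmxA.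
Qed.

Definition delta (x : 'rV[F]_n) : CF F R n := [ffun y => (y == x)%:R].

Lemma actC_delta g x : g \in unitmx -> actC g (delta (x *m g)) = delta x.
Proof.
move=> gu; apply/ffunP=> y; rewrite !ffunE; congr (nat_of_bool _)%:R.
by rewrite (inj_eq (can_inj (mulmxK gu))).
Qed.

(** The delta function restricts the sum to P_n, where an eigenvector is supported on N_n; only the
    trivial coset contributes. *)
Lemma Iform_eigen W W' : Wm W -> Wm' W' -> W 1%:M = 1 -> W' 1%:M = 1 ->
  colU_eigen chi W -> Iform W W' (delta (eta F n)) = 1.
Proof.
move=> m m' e e' We.
pose H x := W x * W' x * delta (eta F n) (eta F n *m x).
rewrite -[LHS]/(Nsum H) Nsum_supp => [|u x uN _|x xu xN].
- by rewrite /H e e' mulmx1 ffunE eqxx !mulr1.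
- exact: Iform_summand_N.
rewrite /H ffunE; case: eqP => [ex|_]; last by rewrite mulr0.
have [->|Wx] := eqVneq (W x) 0; first by rewrite !mul0r.
case/negP: xN; apply: (eigen_support chiP WmP m We (leqnn n)) => //.
  by rewrite block_full.
by rewrite -eta_erow.
Qed.

Lemma trilinear_eq0 T W1 W1' : (0 < n)%N -> ~ exceptional chi chi' Wm Wm' ->
  inv_trilinear Wm Wm' T -> Wm W1 -> Wm' W1' -> W1 1%:M = 1 -> W1' 1%:M = 1 ->
  colU_eigen chi W1 -> T W1 W1' (delta (eta F n)) = 0 ->
  forall W W' Phi, Wm W -> Wm' W' -> T W W' Phi = 0.
Proof.
move=> n0 nonexc [Tl Tm Tr Tg] m1 m1' e1 e1' We T1 W W' Phi m m'.
case: (WmP) (WmP') => Wl Wrt WN _ _ [Wl' Wrt' WN' _ _].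
have bil x : bilinear_on Wm Wm' (fun W W' => T W W' (delta x)).
  by split=> *; [apply: Tl | apply: Tm].
have T_delta0 X X' : Wm X -> Wm' X' -> T X X' (delta 0) = 0.
  move=> mX mX'; apply/eqP; apply: contraT => ne0; case: nonexc.
  (* At t = n a generator would need an index [m >= n.+1], against [m <= n]: the zeroth derivative
     is the whole space. *)
  have nogen c (P : WF F R n -> Prop) x : ~ der_gens c P n x.
    move=> [j [u [Y [_ jn _ [[nj _]|[nj _]]]]]].
      by have := leq_trans (ltnW nj) jn; rewrite ltnn.
    by move: jn; rewrite nj ltnn.
  exists n; split; first by rewrite n0 leqnn.
  exists (fun W W' => T W W' (delta 0)); split.
  - exact: bil.
  - move=> x Y' xS mY'.
    apply: (span_vanish (P := Wm) (phi := fun x => T x Y' (delta 0))) xS => //.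
    + by exists X.
    + by move=> *; apply: Tl.
    by move=> y /nogen.
  - move=> Y x mY xS.
    apply: (span_vanish (P := Wm') (phi := fun x => T Y x (delta 0))) xS => //.
    + by exists X'.
    + by move=> *; apply: Tm.
    by move=> y /nogen.
  - move=> h Y Y'; rewrite block_full => hu mY mY'.
    by rewrite -[in LHS](actC_delta 0 hu) mul0mx Tg.
  - by exists X, X'.
have T_stab g X X' : g \in unitmx -> eta F n *m g = eta F n -> Wm X -> Wm' X' ->
    T (rt g X) (rt g X') (delta (eta F n)) = T X X' (delta (eta F n)).
  by move=> gu ge mX mX'; rewrite -[in LHS](actC_delta _ gu) ge Tg.
have kn : (n.-1 < n)%N by rewrite prednK.
(* At level n-1 the range [n.-1 < j < n] is empty, so only invariance under the stabiliser P_n of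
   [eta] has to be checked. *)
have T_eta X X' : Wm X -> Wm' X' -> T X X' (delta (eta F n)) = 0.
  apply: (mirabolic_form_inj (B := fun X X' => T X X' (delta (eta F n)))
    chiP WmP WmP' nonexc m1 m1' e1 e1' We kn) => //.
  split.
  - exact: bil.
  - move=> h Y Y' hb; apply: T_stab; first by case/andP: hb.
    by rewrite eta_erow (block_erow _ hb).
  - move=> y Y Y'; apply: T_stab; first by rewrite colU_unit // ltnW.
    by rewrite eta_erow erow_colU // ltnW.
  - by move=> j y Y Y' /andP[]; rewrite prednK // => nj; rewrite ltnNge nj.
  - by move=> j y Y Y' /andP[]; rewrite prednK // => nj; rewrite ltnNge nj.
have eta0 : eta F n != 0.
  apply/rV0Pn; exists (Ordinal kn); rewrite mxE /= prednK // eqxx; exact: oner_neq0.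
(* The delta functions span, and each one with [x != 0] is a G_n-translate of the one at [eta]. *)
have -> : Phi = \sum_x Phi x *: delta x.
  apply/ffunP=> y; rewrite sum_ffunE (bigD1 y) //= !ffunE eqxx -[_ *: _]/(_ * _) mulr1.
  rewrite big1 ?addr0 // => x xy; rewrite !ffunE eq_sym (negPf xy).
  exact: mulr0.
have T0 : T W W' 0 = 0.
  by have := Tr (-1) W W' 0 0 m m'; rewrite scaler0 addr0 mulN1r addNr.
elim/big_rec: _ => // x Psi _ IH; rewrite Tr // IH addr0.
have [->|x0] := eqVneq x 0; first by rewrite T_delta0 ?mulr0.
have [g gu <-] := GL_transitive eta0 x0.
by rewrite -(Tg g) // actC_delta // T_eta ?mulr0 //; [apply: Wrt | apply: Wrt'].
Qed.

End Trilinear.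

(** * Existence and uniqueness of the proportionality constant *)

Theorem theorem3p13 (F : finFieldType) (R : comNzRingType) (p : nat)
    (zeta : R) (f : F -> 'F_p) (n : nat)
    (V V' : lmodType R) (rho : 'M[F]_n -> V -> V) (rho' : 'M[F]_n -> V' -> V')
    (lam : V -> R) (lam' : V' -> R) :
  noetherian R ->
  Zp_zeta_data zeta f ->
  (1 <= n)%N ->
  is_rep rho -> is_rep rho' ->
  whittaker_functional (psiR zeta f) rho lam ->
  whittaker_functional (psiR_inv zeta f) rho' lam' ->
  ~ exceptional (psiR zeta f) (psiR_inv zeta f)
      (whittaker_model rho lam) (whittaker_model rho' lam') ->
  inv_trilinear (whittaker_model rho lam) (whittaker_model rho' lam')
    (@Iform F R n) /\
  (forall T, inv_trilinear (whittaker_model rho lam) (whittaker_model rho' lam') T ->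
     exists! c : R, forall W W' Phi,
       whittaker_model rho lam W -> whittaker_model rho' lam' W' ->
       T W W' Phi = c * Iform W W' Phi).
Proof.
move=> _ /add_char_psiR chiP n0 repV repV' lamP lamP' nonexc.
have WmP := whittaker_modelP repV lamP; have WmP' := whittaker_modelP repV' lamP'.
have Iinv := Iform_invariant chiP WmP WmP'; split=> // T TP.
have [W1 [m1 e1 We]] := exists_eigen chiP WmP.
have [_ _ _ [W1' [m1' e1']] _] := WmP'.
have I1 := Iform_eigen chiP WmP WmP' m1 m1' e1 e1' We.
(* The constant is forced, since I takes the value 1 on this test triple. *)
exists (T W1 W1' (delta R (eta F n))); split; last first.
  by move=> c ->; rewrite // I1 mulr1.
move=> W W' Phi m m'; apply/eqP; rewrite -subr_eq0; apply/eqP.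
(* The difference [D] is again invariant and trilinear, and it vanishes on the test triple. *)
set c := T W1 _ _; pose D X X' Psi := T X X' Psi - c * Iform X X' Psi.
apply: (trilinear_eq0 chiP WmP WmP' (T := D) n0 nonexc _ m1 m1' e1 e1' We) => //.
  case: TP Iinv => Tl Tm Tr Tg [Il Im Ir Ig]; split.
  - by move=> a X1 X2 X' Psi *; rewrite /D Tl // Il // mulrDr mulrBr opprD addrACA mulrCA.
  - by move=> a X X1 X2 Psi *; rewrite /D Tm // Im // mulrDr mulrBr opprD addrACA mulrCA.
  - by move=> a X X' P1 P2 *; rewrite /D Tr // Ir // mulrDr mulrBr opprD addrACA mulrCA.
  - by move=> g X X' Psi *; rewrite /D Tg // Ig.
by rewrite /D I1 mulr1 subrr.
Qed.
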